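(* Let $k\in\mathbb{N}$ (a positive integer). A Hausdorff space $X$ has a rank $k$-diagonal if and only if $\mathcal{F}(X)$ has a rank $k$-diagonal.
   Context: For a Hausdorff space $X$, $\mathcal{F}(X)$ is the set of all nonempty finite subsets of $X$ with the Vietoris topology, whose basic open sets are $\{F\in\mathcal{F}(X): F\subset\bigcup_{i=1}^r U_i \text{ and } F\cap U_j\neq\emptyset \text{ for } 1\le j\le r\}$ with $r\in\mathbb{N}$ and $U_1,\dots,U_r$ open in $X$. For a space $Y$, $A\subset Y$ and a family $\gamma$ of subsets of $Y$, put $\mathrm{st}(A,\gamma)=\bigcup\{U\in\gamma:U\cap A\neq\emptyset\}$, $\mathrm{st}^0(A,\gamma)=A$, and $\mathrm{st}^{n+1}(A,\gamma)=\mathrm{st}(\mathrm{st}^n(A,\gamma),\gamma)$; write $\mathrm{st}^n(y,\gamma)$ for $\mathrm{st}^n(\{y\},\gamma)$. The space $Y$ has a rank $k$-diagonal if there is a countable family $\{\gamma_n:n\in\omega\}$ of open covers of $Y$ such that $\{y\}=\bigcap\{\mathrm{st}^k(y,\gamma_n):n\in\omega\}$ for each $y\in Y$. *)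

(* Defs.v *)
From HB Require Import structures.
From mathcomp Require Import all_boot finmap.
From mathcomp Require Import all_classical topology.

Set Implicit Arguments.
Unset Strict Implicit.
Unset Printing Implicit Defensive.

Local Open Scope classical_set_scope.

Record finite_hyperspace (X : topologicalType) := FiniteHyperspace {
  fhval : {fset X};
  _ : fhval != fset0
}.

HB.instance Definition _ (X : topologicalType) :=
  [isSub for @fhval X].
HB.instance Definition _ (X : topologicalType) :=
  [Choice of finite_hyperspace X by <:].

(* Only the values [U i] with [i < r] matter; [U 0], ..., [U r.-1] play the
   role of U_1, ..., U_r. *)
Definition vietoris_basic (X : topologicalType) (U : nat * (nat -> set X)) :
    set (finite_hyperspace X) :=
  [set F : finite_hyperspace X | [set` fhval F] `<=` \bigcup_(i < U.1) U.2 i /\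
     forall j, (j < U.1)%N -> [set` fhval F] `&` U.2 j !=set0].

Definition vietoris_index (X : topologicalType) : set (nat * (nat -> set X)) :=
  [set U | (0 < U.1)%N /\ forall i, (i < U.1)%N -> open (U.2 i)].

Lemma vietoris_basic_cover (X : topologicalType) :
  \bigcup_(U in @vietoris_index X) vietoris_basic U = setT.
Proof.
rewrite -subTset => F _; exists (1, fun=> setT); first by split=> // i _; exact: openT.
split=> [x _|j _]; first by exists 0.
have /fset0Pn[x xF] := valP F.
by exists x.
Qed.

Lemma vietoris_basic_join (X : topologicalType)
    (U V : nat * (nat -> set X)) (F : finite_hyperspace X) :
  vietoris_index U -> vietoris_index V ->
  vietoris_basic U F -> vietoris_basic V F ->
  exists W, [/\ vietoris_index W, vietoris_basic W F &
    vietoris_basic W `<=` vietoris_basic U `&` vietoris_basic V].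
Proof.
case: U V => [r U] [s V] [/= r0 oU] [/= s0 oV] [/= FU UF] [/= FV VF].
pose UU := \bigcup_(i < r) U i; pose VV := \bigcup_(i < s) V i.
have oUU : open UU by apply: bigcup_open => i; exact: oU.
have oVV : open VV by apply: bigcup_open => i; exact: oV.
exists (r + s, fun i => if (i < r)%N then U i `&` VV else V (i - r) `&` UU).
split.
- split=> /= [|i irs]; first by rewrite addn_gt0 r0.
  case: ltnP => ir; apply: openI => //; first exact: oU.
  by apply: oV; rewrite ltn_subLR.
- split=> /= [x xF|j jrs].
    have [i ir Uix] := FU _ xF; exists i => /=; first exact: ltn_addr.
    by rewrite ir; split=> //; exact: FV.
  case: ltnP => jr.
    by have [x [xF Ux]] := UF j jr; exists x; do !split => //; exact: FV.
  have js : (j - r < s)%N by rewrite ltn_subLR.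
  by have [x [xF Vx]] := VF _ js; exists x; do !split => //; exact: FU.
- move=> G [/= GW WG]; split; split=> /=.
  + move=> x /GW[i /= _]; case: ltnP => ir [H1 H2] //.
    by exists i.
  + move=> j jr; have [|x [xG]] := WG j; first exact: ltn_addr.
    by rewrite jr => -[Ux _]; exists x.
  + move=> x /GW[i /= irs]; case: ltnP => ir [H1 H2] //.
    by exists (i - r) => //=; rewrite ltn_subLR.
  + move=> j js; have [|x [xG]] := WG (r + j); first by rewrite ltn_add2l.
    by rewrite ltnNge leq_addr /= addKn => -[Vx _]; exists x.
Qed.

HB.instance Definition _ (X : topologicalType) :=
  @isBaseTopological.Build (finite_hyperspace X)
    (nat * (nat -> set X))%type (@vietoris_index X) (@vietoris_basic X)
    (@vietoris_basic_cover X) (@vietoris_basic_join X).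

Lemma open_finite_hyperspaceE (X : topologicalType)
    (A : set (finite_hyperspace X)) :
  open A <-> exists2 D, D `<=` @vietoris_index X &
                        \bigcup_(U in D) vietoris_basic U = A.
Proof. by []. Qed.

Section RankDiagonal.
Variable Y : topologicalType.

Definition star (A : set Y) (g : set (set Y)) : set Y :=
  \bigcup_(U in [set U | g U /\ U `&` A !=set0]) U.

Definition iter_star (n : nat) (A : set Y) (g : set (set Y)) : set Y :=
  iter n (star^~ g) A.

Definition open_cover (g : set (set Y)) : Prop :=
  g `<=` open /\ \bigcup_(U in g) U = setT.

Definition rank_diagonal (k : nat) : Prop :=
  exists gamma : nat -> set (set Y),
    (forall n, open_cover (gamma n)) /\
    (forall y, [set y] = \bigcap_n iter_star k [set y] (gamma n)).

End RankDiagonal.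

(* Main.v *)
Require Import Defs.
From mathcomp Require Import all_boot finmap.
From mathcomp Require Import all_classical topology.

(** A rank [k]-diagonal pulls back along continuous injections, and [X] embeds
    in its finite hyperspace by [x |-> {x}]; this settles one direction
    ([rank_diagonal_inj]).

    For the other, an open cover [g] of [X] induces the cover of the hyperspace
    by the Vietoris sets [<U_1, ..., U_r>] with all [U_i] in [g].  Two finite
    sets in a common such set are matched point by point: every point of one
    shares some [U_i] with a point of the other.  Following the matches along a
    chain of [k] such steps from [F] to [G], every [x] in [F] has some [y] in
    [G] inside [st^k(x, g)], and every [y] in [G] lies in [st^k(x, g)] for some
    [x] in [F] ([iter_star_vietoris_forth], [iter_star_vietoris_back]).  If [G]
    lies in the [k]-th star of [F] for all covers of the sequence, then for each
    [x] the partner [y] depends on the cover; but when the covers decrease, one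
    of the finitely many [y] in [G] serves all of them ([fset_pigeonhole]), and
    the rank [k]-diagonal of [X] forces [y = x].  Thus [F] is a subset of [G],
    and symmetrically.  A rank [k]-diagonal can always be witnessed by
    decreasing covers, by passing to common refinements
    ([rank_diagonal_decreasing]). *)

Set Implicit Arguments.
Unset Strict Implicit.
Unset Printing Implicit Defensive.

Local Open Scope classical_set_scope.

Section Stars.
Variable Y : topologicalType.
Implicit Types (A B : set Y) (g h : set (set Y)).

Lemma iter_starS n A g y : iter_star n.+1 A g y <->
  exists U z, [/\ g U, U y, U z & iter_star n A g z].
Proof.
split=> [[U [gU [z [Uz sz]]] Uy]|[U [z [gU Uy Uz sz]]]]; first by exists U, z.
by exists U => //; split=> //; exists z.
Qed.

Lemma subset_iter_star n A g : open_cover g -> A `<=` iter_star n A g.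
Proof.
move=> [_ gT] y Ay; elim: n => // n IHn; apply/iter_starS.
have [U gU Uy] : (\bigcup_(U in g) U) y by rewrite gT.
by exists U, y.
Qed.

Lemma iter_star_refine n A g h :
  (forall V, g V -> exists2 U, h U & V `<=` U) ->
  iter_star n A g `<=` iter_star n A h.
Proof.
move=> gh; elim: n => // n IHn y /iter_starS[V [z [gV Vy Vz sz]]].
have [U hU VU] := gh _ gV; apply/iter_starS.
by exists U, z; split=> //; [exact: VU|exact: VU|exact: IHn].
Qed.

Lemma rank_diagonalP k : rank_diagonal Y k <->
  exists gamma : nat -> set (set Y), (forall n, open_cover (gamma n)) /\
    forall y z, (forall n, iter_star k [set y] (gamma n) z) -> z = y.
Proof.
split=> -[gamma [gcov gP]]; exists gamma; split=> // y.
  by move=> z yz; have : [set y] z by rewrite gP => n _; exact: yz.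
apply/seteqP; split=> [z -> n _|z yz]; first exact: subset_iter_star.
by apply: gP => n; exact: yz.
Qed.

(** Taking all open sets that refine the first [n.+1] covers, rather than only
    the intersections of their members, makes the new families decrease under
    inclusion and not merely under refinement. *)
Definition common_refinement (gamma : nat -> set (set Y)) (n : nat) :
    set (set Y) :=
  [set V | open V /\ forall i, (i <= n)%N -> exists2 U, gamma i U & V `<=` U].

Lemma common_refinement_decr gamma m n : (m <= n)%N ->
  common_refinement gamma n `<=` common_refinement gamma m.
Proof.
by move=> mn V [oV Vn]; split=> // i im; apply: Vn; exact: leq_trans mn.
Qed.

Lemma open_cover_common_refinement gamma n :
  (forall i, open_cover (gamma i)) -> open_cover (common_refinement gamma n).
Proof.
move=> gcov; split=> [V []//|]; rewrite -subTset => y _.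
suff [V [oV Vn] Vy] : exists2 V, common_refinement gamma n V & V y.
  by exists V.
have gy i : exists2 U, gamma i U & U y.
  have [_ gT] := gcov i.
  have [U gU Uy] : (\bigcup_(U in gamma i) U) y by rewrite gT.
  by exists U.
elim: n => [|n [V [oV Vn] Vy]].
  have [U gU Uy] := gy 0%N; exists U => //; split=> [|i]; first exact: (gcov 0%N).1.
  by rewrite leqn0 => /eqP ->; exists U.
have [U gU Uy] := gy n.+1; exists (V `&` U); last by split.
split=> [|i]; first by apply: openI => //; exact: (gcov n.+1).1.
rewrite leq_eqVlt => /predU1P[->|/Vn[W gW VW]]; first by exists U => // z [].
by exists W => // z [/VW].
Qed.

Lemma rank_diagonal_decreasing k : rank_diagonal Y k ->
  exists gamma : nat -> set (set Y), [/\ forall n, open_cover (gamma n),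
    forall m n, (m <= n)%N -> gamma n `<=` gamma m &
    forall y z, (forall n, iter_star k [set y] (gamma n) z) -> z = y].
Proof.
move=> /rank_diagonalP[gamma [gcov gP]]; exists (common_refinement gamma).
split=> [n|m n|y z yz]; first exact: open_cover_common_refinement.
  exact: common_refinement_decr.
apply: gP => n; apply: iter_star_refine (yz n) => V [_]; exact.
Qed.

End Stars.

Lemma iter_star_preimage (Y Z : topologicalType) (f : Y -> Z) n (y : Y)
    (g : set (set Z)) :
  iter_star n [set y] (preimage f @` g) `<=`
  f @^-1` iter_star n [set f y] g.
Proof.
elim: n => [z ->//|n IHn z /iter_starS[_ [w [[U gU <-] Uz Uw sw]]]].
by apply/iter_starS; exists U, (f w); split=> //; exact: IHn.
Qed.

Lemma rank_diagonal_inj (Y Z : topologicalType) (f : Y -> Z) k :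
  continuous f -> injective f -> rank_diagonal Z k -> rank_diagonal Y k.
Proof.
move=> /continuousP fc fI /rank_diagonalP[gamma [gcov gP]].
apply/rank_diagonalP; exists (fun n => preimage f @` gamma n); split=> [n|y z yz].
  have [go gT] := gcov n; split=> [_ [U gU <-]|]; first exact/fc/go.
  rewrite -subTset => y _.
  have [U gU Uy] : (\bigcup_(U in gamma n) U) (f y) by rewrite gT.
  by exists (f @^-1` U) => //; exists U.
by apply/fI/gP => n; exact: iter_star_preimage.
Qed.

(** For predicates that decrease with [n], a witness in a finite set can be
    chosen uniformly in [n]: otherwise each [x] in [F] fails from some stage on,
    and all of them fail at the largest of these stages. *)
Lemma fset_pigeonhole (T : choiceType) (F : {fset T}) (P : nat -> T -> Prop) :
  (forall m n x, (m <= n)%N -> P n x -> P m x) ->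
  (forall n, exists2 x, x \in F & P n x) ->
  exists2 x, x \in F & forall n, P n x.
Proof.
move=> Pdecr PF; apply: contrapT => noF.
have /choice[N NP] x : exists n, x \in F -> ~ P n x.
  have [xF|] := boolP (x \in F); last by exists 0%N.
  apply: contrapT => Nx; apply: noF; exists x => // n.
  by apply: contrapT => nP; apply: Nx; exists n.
have [x xF Px] := PF (\max_(x <- enum_fset F) N x)%N.
by apply: (NP x xF); apply: Pdecr Px; exact: leq_bigmax_seq.
Qed.

Section Hyperspace.
Variable X : topologicalType.
Implicit Types (F G : finite_hyperspace X) (g : set (set X)).

Lemma fset1_neq0 (x : X) : [fset x]%fset != fset0.
Proof. by apply/fset0Pn; exists x; rewrite inE. Qed.

Definition singleton (x : X) : finite_hyperspace X :=
  FiniteHyperspace (fset1_neq0 x).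

Lemma singleton_inj : injective singleton.
Proof. by move=> x y /(congr1 val)/= /fset1_inj. Qed.

Lemma open_vietoris_basic U : vietoris_index U -> open (@vietoris_basic X U).
Proof.
move=> Ui; apply/open_finite_hyperspaceE.
by exists [set U]; rewrite ?bigcup_set1// => _ ->.
Qed.

Lemma continuous_singleton : continuous singleton.
Proof.
apply/continuousP => _ /open_finite_hyperspaceE[D Di <-].
rewrite preimage_bigcup; apply: bigcup_open => -[r U] /Di[/= r0 oU].
(* The Vietoris set of U_1, ..., U_r pulls back to their intersection, the
   inclusion in the union following from r > 0. *)
suff -> : singleton @^-1` vietoris_basic (r, U) = \bigcap_(i in `I_r) U i.
  by rewrite bigcap_mkord; apply: big_ind => //;
     [exact: openT|exact: openI|move=> i _; exact: oU].
apply/seteqP; split=> x /=.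
  by move=> [_ xU] j /xU[y []]; rewrite /= inE => /eqP ->.
move=> xU; split=> [y|j jr].
  by rewrite /= inE => /eqP ->; exists 0%N => //; exact: xU.
by exists x; split; [rewrite /= inE|exact: xU].
Qed.

Definition vietoris_cover g : set (set (finite_hyperspace X)) :=
  @vietoris_basic X @`
    [set U | (0 < U.1)%N /\ forall i, (i < U.1)%N -> g (U.2 i)].

Lemma open_vietoris_cover g : open_cover g -> open_cover (vietoris_cover g).
Proof.
move=> [go gT]; split=> [_ [U [U0 gU] <-]|].
  by apply: open_vietoris_basic; split=> // i /gU/go.
rewrite -subTset => F _.
have /choice[V gV] x : exists V, g V /\ V x.
  have [V gV Vx] : (\bigcup_(V in g) V) x by rewrite gT.
  by exists V.
have /fset0Pn[x0 x0F] := valP F.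
(* One member of g around each point of F, indexed along an enumeration. *)
pose s := enum_fset (fhval F); pose U j := V (nth x0 s j).
exists (vietoris_basic (size s, U)).
  exists (size s, U) => //; split=> [|i _] /=; last exact: (gV _).1.
  by rewrite -has_predT; apply/hasP; exists x0.
split=> [x xF|j js] /=.
  exists (index x s); first by rewrite /= index_mem.
  by rewrite /U nth_index//; exact: (gV _).2.
by exists (nth x0 s j); split; [exact: mem_nth|exact: (gV _).2].
Qed.

Lemma vietoris_cover_match g (W : set (finite_hyperspace X)) F G x :
  vietoris_cover g W -> W F -> W G -> x \in fhval F ->
  exists U y, [/\ g U, U x, U y & y \in fhval G].
Proof.
move=> [[r U] [/= _ gU] <-] [/= FU _] [/= _ GU] xF.
have [i ir Uix] := FU x xF; have [y [yG Uiy]] := GU i ir.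
by exists (U i), y; split=> //; exact: gU.
Qed.

Lemma iter_star_vietoris_forth g n F G x :
  iter_star n [set F] (vietoris_cover g) G -> x \in fhval F ->
  exists2 y, y \in fhval G & iter_star n [set x] g y.
Proof.
move=> + xF; elim: n G => [G ->|n IHn G]; first by exists x.
move=> /iter_starS[W [H [gW WG WH /IHn[z zH sz]]]].
have [U [y [gU Uz Uy yG]]] := vietoris_cover_match gW WH WG zH.
by exists y => //; apply/iter_starS; exists U, z.
Qed.

Lemma iter_star_vietoris_back g n F G y :
  iter_star n [set F] (vietoris_cover g) G -> y \in fhval G ->
  exists2 x, x \in fhval F & iter_star n [set x] g y.
Proof.
elim: n G y => [G y -> yF|n IHn G y]; first by exists y.
move=> /iter_starS[W [H [gW WG WH sH]]] yG.
have [U [z [gU Uy Uz zH]]] := vietoris_cover_match gW WG WH yG.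
have [x xF sz] := IHn _ _ sH zH.
by exists x => //; apply/iter_starS; exists U, z.
Qed.

Lemma rank_diagonal_hyperspace k :
  rank_diagonal X k -> rank_diagonal (finite_hyperspace X) k.
Proof.
move=> /rank_diagonal_decreasing[gamma [gcov gdecr gP]].
apply/rank_diagonalP; exists (fun n => vietoris_cover (gamma n)).
split=> [n|F G FG]; first exact: open_vietoris_cover.
have stdecr m n x y : (m <= n)%N ->
    iter_star k [set x] (gamma n) y -> iter_star k [set x] (gamma m) y.
  by move=> mn; apply: iter_star_refine => V /(gdecr _ _ mn) gV; exists V.
apply: val_inj; apply/fsetP => x; apply/idP/idP => [xG|xF].
  have [|n|y yF yx] := @fset_pigeonhole _ (fhval F)
    (fun n y => iter_star k [set y] (gamma n) x).
  - by move=> m n y; exact: stdecr.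
  - exact: iter_star_vietoris_back (FG n) xG.
  - by rewrite (gP _ _ yx).
have [|n|y yG xy] := @fset_pigeonhole _ (fhval G)
  (fun n y => iter_star k [set x] (gamma n) y).
- by move=> m n y; exact: stdecr.
- exact: iter_star_vietoris_forth (FG n) xF.
- by rewrite -(gP _ _ xy).
Qed.

End Hyperspace.

Theorem theorem5p3 (k : nat) (hk : (0 < k)%N) (X : topologicalType)
    (hX : hausdorff_space X) :
  rank_diagonal X k <-> rank_diagonal (finite_hyperspace X) k.
Proof.
split; first exact: rank_diagonal_hyperspace.
apply: rank_diagonal_inj; first exact: continuous_singleton.
exact: singleton_inj.
Qed.
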